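(* Let $F$ be a quadratically closed field of characteristic $3$. Then every two totally cyclically linked division symbol $p$-algebras of degree $3$ over $F$ (with $p=3$) are inseparably linked.
   Context: A field is quadratically closed if it has no quadratic field extension. For a field $F$ of characteristic $3$, a symbol $p$-algebra of degree $3$ over $F$ is an algebra of the form $[\alpha,\beta)_{3,F}=F\langle x,y : x^3-x=\alpha,\ y^3=\beta,\ yxy^{-1}=x+1\rangle$ with $\alpha\in F$ and $\beta\in F^\times$; it is a central simple $F$-algebra of degree $3$ (dimension $9$). Two division symbol algebras of degree $3$ over $F$ are totally cyclically linked if every cyclic (Galois) degree $3$ field extension of $F$ that embeds (as an $F$-algebra) into one of them also embeds into the other. They are inseparably linked if they share a purely inseparable degree $3$ field extension of $F$, i.e. there is a purely inseparable field extension of degree $3$ of $F$ that embeds into both of them. *)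

(* Defs.v *)
From HB Require Import structures.
From mathcomp Require Import all_boot all_algebra all_fingroup all_solvable.
From mathcomp Require Import all_field.

Set Implicit Arguments.
Unset Strict Implicit.
Unset Printing Implicit Defensive.

Import GRing.Theory.
Local Open Scope ring_scope.

Definition quadratically_closed (F : fieldType) : Prop :=
  forall L : fieldExtType F, \dim {:L} <> 2%N.

(* When b != 0, the second relation makes y a unit, so y^-1 is then the
   genuine inverse and not a default value. *)
Definition symbol3_relations (F : fieldType) (a b : F) (A : unitAlgType F)
    (x y : A) : Prop :=
  [/\ x ^+ 3 - x = a%:A, y ^+ 3 = b%:A & y * x * y^-1 = x + 1].

(* The presentation F<x, y : relations>, expressed by its universal property;
   it determines A up to isomorphism of F-algebras. *)
Definition presents_symbol3 (F : fieldType) (a b : F) (A : unitAlgType F)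
    (x y : A) : Prop :=
  symbol3_relations a b x y /\
  forall (B : unitAlgType F) (u v : B), symbol3_relations a b u v ->
    (exists f : {lrmorphism A -> B}, f x = u /\ f y = v) /\
    (forall f g : {lrmorphism A -> B},
       f x = u -> f y = v -> g x = u -> g y = v -> f =1 g).

Definition is_symbol3_algebra (F : fieldType) (A : unitAlgType F) : Prop :=
  exists a b : F, b != 0 /\ exists x y : A, presents_symbol3 a b x y.

Definition is_division_algebra (F : fieldType) (A : unitAlgType F) : Prop :=
  forall z : A, z != 0 -> z \is a GRing.unit.

Definition embeds_in (F : fieldType) (K : fieldExtType F) (A : unitAlgType F)
    : Prop :=
  exists f : {lrmorphism K -> A}, injective f.

(* No generality is lost by taking K in splittingFieldType, on which galois is
   defined: every finite Galois extension is a splitting field. *)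
Definition cyclic_cubic_extension (F : fieldType) (K : splittingFieldType F)
    : Prop :=
  [/\ \dim {:K} = 3%N, galois 1%AS {:K}%AS & cyclic 'Gal({:K}%AS / 1%AS)].

Definition totally_cyclically_linked (F : fieldType) (A B : unitAlgType F)
    : Prop :=
  forall K : splittingFieldType F, cyclic_cubic_extension K ->
    (embeds_in K A <-> embeds_in K B).

Definition inseparably_linked (F : fieldType) (A B : unitAlgType F) : Prop :=
  exists K : fieldExtType F,
    [/\ \dim {:K} = 3%N, purely_inseparable 1%AS {:K}%AS,
        embeds_in K A & embeds_in K B].

(* Main.v *)
Require Import Defs.
From HB Require Import structures.
From mathcomp Require Import all_boot all_algebra all_fingroup all_solvable.
From mathcomp Require Import all_field ring.
From Stdlib Require Import Classical_Prop.

(** Let A be generated by x and y with x ^+ 3 - x = a, y ^+ 3 = b and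
    y x = (x + 1) y.  The two algebras share the cyclic field L = F(x), whose
    Galois group is generated by sigma : x |-> x + 1, and for k in L the
    element k y^-1 of A has the cube N(k) / b in F, N being the norm of L / F.
    It is therefore enough to find, up to a cube of F, one of the values
    N(k) / b among the cubes of the noncentral elements of B with a cube in F.

    The first point is that 1 / b is, up to a cube, the reduced norm of an
    element of B.  Over a quadratically closed field some d satisfies
    d ^ 2 + d + b ^ 2 - a ^ 2 = 0, and then z = y + (d - x ^ 2) y^-1 satisfies
    z ^+ 3 - z = d ^ 3 / b.  So z generates a cyclic cubic field, total linkage
    provides w in B with w ^+ 3 - w = d ^ 3 / b, and the constant term says
    that w has the reduced norm d ^ 3 / b ([symbol3_cyclic_generator]).

    The second point is to correct w by a factor k from the copy of L in B so
    that k w has a cube in F.  The reduced characteristic polynomial of an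
    element u of B is X^3 - trd u X^2 + (trd (u ^+ 2) - (trd u) ^ 2) X - nrd u,
    so one needs trd (k w) = 0 and trd ((k w) ^+ 2) = 0.  The first condition
    is linear on the three-dimensional space L; on a plane of solutions the
    second one is a binary quadratic form, which is isotropic because F is
    quadratically closed ([twist_into_pure_cube]).  Then (k w) ^+ 3 =
    nrd k * nrd w = N(k) d ^ 3 / b = (d k y^-1) ^+ 3, and both algebras contain
    the purely inseparable field generated by a cube root of this scalar.

    The reduced trace and norm are obtained from the representation of a
    symbol algebra by 3 x 3 matrices over its own cyclic subfield
    ([split_representation]). *)

Set Implicit Arguments.
Unset Strict Implicit.
Unset Printing Implicit Defensive.

Import GRing.Theory.
Local Open Scope ring_scope.

(** * Subfields generated by elements of a division algebra *)

Lemma irreducible_annihilator (F : fieldType) (A : algType F) (z : A)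
    (p q : {poly F}) :
  irreducible_poly p -> horner_alg z p = 0 -> horner_alg z q = 0 -> p %| q.
Proof.
move=> irr_p pz qz; have [/Bezout_eq1_coprimepP[u /(congr1 (horner_alg z))]|] :=
  boolP (coprimep p q).
  rewrite rmorphD !rmorphM /= pz qz !mulr0 addr0 rmorph1 => /eqP.
  by rewrite eq_sym oner_eq0.
by move/(irr_p _)/(_ (dvdp_gcdl p q))/eqp_dvdl <-; apply: dvdp_gcdr.
Qed.

(** A simple extension is the quotient of the polynomial ring by the minimal
    polynomial of its generator, so a root of that polynomial in any algebra,
    commutative or not, gives a morphism. *)
Lemma embed_simple_extension (F : fieldType) (K : fieldExtType F) (zeta : K)
    (p : {poly F}) (A : unitAlgType F) (z : A) :
    irreducible_poly p -> <<1; zeta>>%VS = fullv ->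
    horner_alg zeta p = 0 -> horner_alg z p = 0 ->
  exists f : {lrmorphism K -> A}, f zeta = z.
Proof.
move=> irr_p genK p_zeta p_z.
have repK v : exists q, v == horner_alg zeta q.
  have /Fadjoin1_polyP[q ->]: v \in <<1; zeta>>%VS by rewrite genK memvf.
  by exists q.
pose f v := horner_alg z (xchoose (repK v)).
have fE q : f (horner_alg zeta q) = horner_alg z q.
  rewrite /f; set r := xchoose _.
  have Dr : horner_alg zeta q = horner_alg zeta r.
    exact/eqP/(xchooseP (repK _)).
  apply/esym/eqP; rewrite -subr_eq0 -rmorphB.
  have /dvdpP[s ->]: p %| q - r.
    apply: (irreducible_annihilator irr_p p_zeta).
    by rewrite rmorphB /= Dr subrr.
  by rewrite rmorphM /= p_z mulr0.
have f_lin : linear f.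
  move=> c u v; have /eqP-> := xchooseP (repK u).
  have /eqP-> := xchooseP (repK v).
  rewrite !fE -[c *: horner_alg zeta _]mulr_algl -(horner_algC zeta).
  by rewrite -rmorphM -rmorphD fE rmorphD rmorphM /= horner_algC mulr_algl.
have f_mon : monoid_morphism f.
  split=> [|u v]; first by rewrite -(rmorph1 (horner_alg zeta)) fE rmorph1.
  have /eqP-> := xchooseP (repK u); have /eqP-> := xchooseP (repK v).
  by rewrite !fE -rmorphM fE rmorphM.
pose fL := GRing.isLinear.Build F K A *:%R f f_lin.
pose fM := GRing.isMonoidMorphism.Build K A f f_mon.
pose g : {lrmorphism K -> A} := HB.pack f fL fM.
exists g; rewrite /= -[in LHS](horner_algX zeta) fE; exact: horner_algX.
Qed.

Lemma quadratically_closed_root (F : fieldType) (q : {poly F}) :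
  quadratically_closed F -> size q = 3%N -> exists c, root q c.
Proof.
move=> qcF q3; apply: NNPP => q'root.
have irr_q : irreducible_poly q.
  apply: cubic_irreducible => [|c]; first by rewrite q3.
  by apply/negP=> qc0; apply: q'root; exists c.
by have [L dimL _] := irredp_FAdjoin irr_q; apply: (qcF L); rewrite dimL q3.
Qed.

(** A quadratic polynomial over [F] splits, so in a division algebra it can
    only kill scalars. *)
Lemma nonscalar_free (F : fieldType) (A : unitAlgType F) (z : A)
    (q : {poly F}) :
    quadratically_closed F -> is_division_algebra A ->
    (forall c, z <> c%:A) -> (size q <= 3)%N -> horner_alg z q = 0 -> q = 0.
Proof.
move=> qcF divA z'F; have mul_eq0 (u v : A) : u * v = 0 -> u = 0 \/ v = 0.
  move=> uv0; have [->|/divA Uu] := eqVneq u 0; first by left.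
  by right; rewrite -[v](mulKr Uu) uv0 mulr0.
have lin (r : {poly F}) : (size r <= 2)%N -> horner_alg z r = 0 -> r = 0.
  move=> r2 rz; have [//|nz_r] := eqVneq r 0; case: (z'F (- r`_0 / r`_1)).
  have nz_r1 : r`_1 != 0.
    apply: contra_neq nz_r => r1; have r_le1 : (size r <= 1)%N.
      by apply/leq_sizeP=> -[|[|j]] // _; rewrite nth_default // (leq_trans r2).
    move: rz; rewrite (size1_polyC r_le1) horner_algC => /eqP.
    by rewrite scaler_eq0 oner_eq0 orbF => /eqP->.
  have Dr : r = r`_1 *: 'X + (r`_0)%:P.
    apply/polyP=> -[|[|j]]; rewrite coefD coefZ coefX coefC /=.
    - by rewrite mulr0 add0r.
    - by rewrite mulr1 addr0.
    - by rewrite mulr0 addr0 nth_default // (leq_trans r2).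
  move: rz; rewrite {1}Dr rmorphD /= linearZ /= horner_algX horner_algC.
  move/eqP; rewrite mulr_algl addr_eq0 => /eqP/(congr1 ( *:%R (r`_1)^-1)).
  by rewrite scalerA mulVf // scale1r => ->; rewrite -scaleNr scalerA mulrC.
rewrite leq_eqVlt => /orP[/eqP q3|]; last exact: lin.
have [c /factor_theorem[r Dq]] := quadratically_closed_root qcF q3.
have nz_r : r != 0.
  by apply: contra_eq_neq q3 => r0; rewrite Dq r0 mul0r size_poly0.
rewrite Dq rmorphM rmorphB /= horner_algX horner_algC => /mul_eq0[/lin r0 | ].
  rewrite r0 ?mul0r // -ltnS -q3 Dq size_mul ?polyXsubC_eq0 //.
  by rewrite size_XsubC addn2.
by move/eqP; rewrite subr_eq0 => /eqP/z'F.
Qed.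

Lemma nonscalar_cubic_irreducible (F : fieldType) (A : unitAlgType F) (z : A)
    (p : {poly F}) :
    quadratically_closed F -> is_division_algebra A ->
    (forall c, z <> c%:A) -> size p = 4%N -> horner_alg z p = 0 ->
  irreducible_poly p.
Proof.
move=> qcF divA z'F p4 pz; apply: cubic_irreducible => [|c].
  by rewrite p4.
apply/negP=> /factor_theorem[q Dp].
have nz_q : q != 0.
  by apply: contra_eq_neq p4 => q0; rewrite Dp q0 mul0r size_poly0.
have q3 : (size q <= 3)%N.
  by rewrite -ltnS -p4 Dp size_mul ?polyXsubC_eq0 // size_XsubC addn2.
move: pz; rewrite Dp rmorphM rmorphB /= horner_algX horner_algC => qz.
have Uz : z - c%:A \is a GRing.unit.
  by apply: divA; rewrite subr_eq0; apply/eqP/z'F.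
move: qz => /(congr1 ( *%R^~ (z - c%:A)^-1)); rewrite mulrK // mul0r => qz.
by case/eqP: nz_q; apply: nonscalar_free qz.
Qed.

Lemma nonscalar_relation (F : fieldType) (A : unitAlgType F) (z : A)
    (c0 c1 c2 : F) :
    quadratically_closed F -> is_division_algebra A ->
    (forall c, z <> c%:A) ->
  c0%:A + c1 *: z + c2 *: z ^+ 2 = 0 -> [/\ c0 = 0, c1 = 0 & c2 = 0].
Proof.
move=> qcF divA z'F c_z0; pose q : {poly F} := Poly [:: c0; c1; c2].
have q0 : q = 0.
  apply: (nonscalar_free qcF divA z'F); first exact: size_Poly.
  rewrite -{}c_z0 /q /= !cons_poly_def.
  rewrite mul0r add0r !(rmorphD, rmorphM) /= horner_algX !horner_algC.
  by rewrite mulrDl !mulr_algl -scalerAl -expr2 addrC [c2 *: _ + _]addrC addrA.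
have c_eq0 i : nth 0 [:: c0; c1; c2] i = 0 by rewrite -coef_Poly -/q q0 coef0.
by split; [apply: (c_eq0 0) | apply: (c_eq0 1) | apply: (c_eq0 2)].
Qed.

(** By [nonscalar_relation], a monic cubic killing a nonscalar element is
    unique; this is how reduced traces and norms are read off below. *)
Lemma nonscalar_cubic_unique (F : fieldType) (A : unitAlgType F) (z : A)
    (t s n t' s' n' : F) :
    quadratically_closed F -> is_division_algebra A ->
    (forall c, z <> c%:A) ->
    z ^+ 3 - t *: z ^+ 2 + s *: z = n%:A ->
    z ^+ 3 - t' *: z ^+ 2 + s' *: z = n'%:A ->
  [/\ t = t', s = s' & n = n'].
Proof.
move=> qcF divA z'F Dn Dn'.
have cancel (X p q r r' : A) :
    X - p + r - (X - q + r') + (r' - r) + (p - q) = 0.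
  rewrite opprD [X - p + r + _]addrACA -[_ + (r' - r)]addrA subrKA subrr addr0.
  by rewrite opprB [X - p + _]addrC subrKA subrKA subrr.
have [] := @nonscalar_relation _ _ z (n - n') (s' - s) (t - t') qcF divA z'F.
  by rewrite (scalerBl n) -Dn -Dn' (scalerBl s') (scalerBl t) cancel.
by move=> /subr0_eq-> /subr0_eq-> /subr0_eq->.
Qed.

Lemma natr3_eq0 (F : fieldType) (A : pzRingType) (f : {rmorphism F -> A}) :
  3%N \in [pchar F] -> 3%:R = 0 :> A.
Proof. by move=> charF3; rewrite -(rmorph_nat f) (pcharf0 charF3) rmorph0. Qed.

Lemma artin_schreier_size (F : fieldType) (a : F) :
  size ('X^3 - 'X - a%:P : {poly F}) = 4%N.
Proof.
rewrite -addrA size_polyDl ?size_polyXn // -opprD size_polyN.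
by rewrite size_XaddC.
Qed.

Lemma horner_alg_artin_schreier (F : fieldType) (A : algType F) (z : A) a :
  horner_alg z ('X^3 - 'X - a%:P) = z ^+ 3 - z - a%:A.
Proof. by rewrite !rmorphB rmorphXn /= horner_algX horner_algC. Qed.

Lemma artin_schreier_cyclic (F : fieldType) (a : F) :
    3%N \in [pchar F] -> irreducible_poly ('X^3 - 'X - a%:P) ->
  exists K : splittingFieldType F,
    cyclic_cubic_extension K /\
    exists2 zeta : K, zeta ^+ 3 - zeta = a%:A & <<1; zeta>>%VS = fullv.
Proof.
move=> charF3 irr_a.
have [L dimL [zeta root_zeta genL]] := irredp_FAdjoin irr_a.
rewrite artin_schreier_size in dimL.
have zetaE : zeta ^+ 3 - zeta = a%:A.
  by apply/eqP; rewrite -subr_eq0 -horner_alg_artin_schreier; apply: root_zeta.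
have three0 : 3%:R = 0 :> {poly L}.
  exact: (natr3_eq0 (polyC \o in_alg L) charF3).
pose rs := [:: zeta; zeta + 1; zeta - 1].
pose p : {poly L} := 'X^3 - 'X - (a%:A)%:P.
have Fp : p \is a polyOver 1%VS.
  apply/polyOver1P; exists ('X^3 - 'X - a%:P).
  by rewrite !rmorphB /= map_polyXn map_polyX map_polyC.
have Dp : p = \prod_(r <- rs) ('X - r%:P).
  rewrite !big_cons big_nil mulr1 rmorphB rmorphD rmorph1 /p -zetaE rmorphB.
  rewrite rmorphXn /=.
  have -> : ('X - zeta%:P) * (('X - (zeta%:P + 1)) * ('X - (zeta%:P - 1)))
     = 'X^3 - 'X - (zeta%:P ^+ 3 - zeta%:P)
       + 3%:R * ('X * zeta%:P ^+ 2 - 'X^2 * zeta%:P) by ring.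
  by rewrite three0 mul0r addr0.
have splitp : splittingFieldFor 1 p {:L}.
  exists rs; first by rewrite Dp eqpxx.
  apply/eqP; rewrite eqEsubv subvf -genL; apply/FadjoinP; split.
    exact: sub1v.
  by apply: seqv_sub_adjoin; rewrite inE eqxx.
pose K : splittingFieldType F :=
  HB.pack L (FieldExt_isSplittingField.Build F L (ex_intro2 _ _ p Fp splitp)).
have nz1 : 1 != 0 :> L := oner_neq0 L.
have nz2 : 1 + 1 != 0 :> L.
  apply: contra_neq nz1 => two0.
  transitivity (3%:R - (1 + 1) : L); first by ring.
  by rewrite two0 subr0; apply: (natr3_eq0 (in_alg L) charF3).
have galK : galois 1%AS {:K}%AS.
  apply/splitting_galoisField; exists p; split=> //.
  rewrite Dp separable_prod_XsubC /= !inE negb_or !andbT -!andbA; apply/and3P.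
  split; rewrite -subr_eq0.
  - by rewrite opprD addNKr oppr_eq0.
  - by rewrite opprB addrC subrK.
  - by have -> : zeta + 1 - (zeta - 1) = 1 + 1 by ring.
exists K; split; last by exists zeta.
split=> //; apply: prime_cyclic; rewrite -galois_dim //.
by rewrite dimv1 divn1 dimL.
Qed.

(** An Artin-Schreier element of a division algebra gives an abstract cyclic
    field that maps to every algebra containing an element with the same
    equation, in particular to itself by [zeta |-> zeta + 1]. *)
Lemma artin_schreier_subfield (F : fieldType) (A : unitAlgType F) (z : A)
    (a : F) :
    3%N \in [pchar F] -> quadratically_closed F -> is_division_algebra A ->
    (forall c, z <> c%:A) -> z ^+ 3 - z = a%:A ->
  exists K : splittingFieldType F, cyclic_cubic_extension K /\
    exists zeta : K,
    [/\ zeta ^+ 3 - zeta = a%:A, <<1; zeta>>%VS = fullv,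
        exists sigma : {lrmorphism K -> K}, sigma zeta = zeta + 1
      & forall (B : unitAlgType F) (w : B), w ^+ 3 - w = a%:A ->
        exists f : {lrmorphism K -> B}, f zeta = w].
Proof.
move=> charF3 qcF divA z'F Dz; pose p : {poly F} := 'X^3 - 'X - a%:P.
have root_p (B : unitAlgType F) (w : B) :
    w ^+ 3 - w = a%:A -> horner_alg w p = 0.
  by move=> Dw; rewrite horner_alg_artin_schreier Dw subrr.
have irr_p : irreducible_poly p.
  apply: nonscalar_cubic_irreducible z'F _ _ => //; last exact: root_p.
  exact: artin_schreier_size.
have [K [cycK [zeta Dzeta genK]]] := artin_schreier_cyclic charF3 irr_p.
have lift (B : unitAlgType F) (w : B) : w ^+ 3 - w = a%:A ->
    exists f : {lrmorphism K -> B}, f zeta = w.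
  by move=> Dw; apply: embed_simple_extension irr_p genK _ _; apply: root_p.
exists K; split=> //; exists zeta; split=> //; apply: lift; rewrite -Dzeta.
transitivity (zeta ^+ 3 - zeta + 3%:R * (zeta ^+ 2 + zeta)); first by ring.
by rewrite (natr3_eq0 (in_alg K) charF3) mul0r addr0.
Qed.

(** The purely inseparable analogue of [artin_schreier_subfield]. *)
Lemma inseparable_cubic_subfield (F : fieldType) (A : unitAlgType F) (e : A)
    (c : F) :
    3%N \in [pchar F] -> quadratically_closed F -> is_division_algebra A ->
    (forall s, e <> s%:A) -> e ^+ 3 = c%:A ->
  exists K : fieldExtType F,
    [/\ \dim {:K} = 3%N, purely_inseparable 1%AS {:K}%AS
      & forall (B : unitAlgType F) (w : B), w ^+ 3 = c%:A -> embeds_in K B].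
Proof.
move=> charF3 qcF divA e'F De; pose p : {poly F} := 'X^3 - c%:P.
have root_p (B : unitAlgType F) (w : B) : w ^+ 3 = c%:A -> horner_alg w p = 0.
  by move=> Dw; rewrite rmorphB rmorphXn /= horner_algX horner_algC Dw subrr.
have size_p : size p = 4%N by rewrite size_XnsubC.
have irr_p : irreducible_poly p.
  by apply: nonscalar_cubic_irreducible e'F _ _ => //; apply: root_p.
have [K dimK [zeta root_zeta genK]] := irredp_FAdjoin irr_p.
exists K; split; first by rewrite dimK size_p.
  apply/purely_inseparableP=> v _; apply/purely_inseparable_elementP_pchar.
  have charK3 : 3%N \in [pchar K] by rewrite pchar_lalg.
  exists 3%N; first by rewrite pnatE.
  have /Fadjoin1_polyP[q ->]: v \in <<1; zeta>>%VS by rewrite genK memvf.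
  have Dzeta : zeta ^+ 3 = c%:A.
    apply/eqP; rewrite -subr_eq0 -(horner_algX zeta) -rmorphXn /=.
    rewrite -(horner_algC zeta) -rmorphB; exact: root_zeta.
  have cube_sum n (u : 'I_n -> K) : (\sum_i u i) ^+ 3 = \sum_i u i ^+ 3.
    exact: (rmorph_sum (pFrobenius_aut charK3)).
  (* The cube of q(zeta) is the sum of the scalars q_i ^ 3 * c ^ i. *)
  rewrite horner_coef cube_sum rpred_sum // => i _.
  rewrite exprMn -exprM mulnC exprM Dzeta coef_map /=.
  by rewrite !exprZn !expr1n mulr_algl scalerA rpredZ ?mem1v.
move=> B w Dw.
have [f _] : exists f : {lrmorphism K -> B}, f zeta = w.
  apply: embed_simple_extension irr_p genK _ _; last exact: root_p.
  by apply/eqP; apply: root_zeta.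
by exists f; apply: fmorph_inj.
Qed.

(** * Cubic Artin-Schreier extensions *)

Section ArtinSchreierField.
Variables (F : fieldType) (K : fieldExtType F) (zeta : K) (a : F).
Hypothesis charF3 : 3%N \in [pchar F].
Hypothesis Dzeta : zeta ^+ 3 - zeta = a%:A.
Hypothesis genK : <<1; zeta>>%VS = fullv.

Lemma artin_schreier_basis (k : K) :
  exists c0 c1 c2 : F, k = c0%:A + c1 *: zeta + c2 *: zeta ^+ 2.
Proof.
pose p : {poly F} := 'X^3 - 'X - a%:P.
have /Fadjoin1_polyP[q ->]: k \in <<1; zeta>>%VS by rewrite genK memvf.
have size_q : (size (q %% p)%R <= 3)%N.
  rewrite -ltnS -[4%N](artin_schreier_size a) ltn_modp -size_poly_gt0.
  by rewrite artin_schreier_size.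
have -> : (map_poly (in_alg K) q).[zeta] = horner_alg zeta (q %% p).
  rewrite -[LHS]/(horner_alg zeta q) [in LHS](divp_eq q p) rmorphD rmorphM /=.
  by rewrite horner_alg_artin_schreier Dzeta subrr mulr0 add0r.
exists (q %% p)`_0, (q %% p)`_1, (q %% p)`_2.
rewrite -[LHS]/((map_poly (in_alg K) (q %% p)).[zeta]).
rewrite (@horner_coef_wide _ 3) ?size_map_poly // !big_ord_recl big_ord0 /=.
by rewrite !coef_map /= addr0 expr0 expr1 mulr1 !mulr_algl addrA.
Qed.

Variable sigma : {lrmorphism K -> K}.
Hypothesis Dsigma : sigma zeta = zeta + 1.

Let morph_basis (B : unitAlgType F) (g : {lrmorphism K -> B}) c0 c1 c2 :
  g (c0%:A + c1 *: zeta + c2 *: zeta ^+ 2)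
    = c0%:A + c1 *: g zeta + c2 *: g zeta ^+ 2.
Proof. by rewrite !rmorphD /= !linearZ /= rmorph1 rmorphXn. Qed.

Lemma artin_schreier_aut_order k : sigma (sigma (sigma k)) = k.
Proof.
have [c0 [c1 [c2 ->]]] := artin_schreier_basis k.
have three0 : 3%:R = 0 :> K := natr3_eq0 (in_alg K) charF3.
have s3 : zeta + 1 + 1 + 1 = zeta.
  by rewrite -!addrA -[1 + (1 + 1)]/(3%:R : K) three0 addr0.
have sE u c d e : sigma (c%:A + d *: u + e *: u ^+ 2)
    = c%:A + d *: sigma u + e *: sigma u ^+ 2.
  by rewrite !rmorphD /= !linearZ /= rmorph1 rmorphXn.
have s1 u : sigma (u + 1) = sigma u + 1 by rewrite rmorphD rmorph1.
by rewrite !sE !(Dsigma, s1) s3.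
Qed.

Lemma artin_schreier_generator_nonscalar c : zeta <> c%:A.
Proof.
move=> Dz; move: Dsigma; rewrite Dz linearZ /= rmorph1 => /eqP.
by rewrite addrC -subr_eq subrr eq_sym oner_eq0.
Qed.

(** In the basis 1, zeta, zeta ^+ 2 one has
    [sigma k - k = (c1 + c2) - c2 * zeta] in characteristic 3. *)
Lemma artin_schreier_aut_fixed k : sigma k = k -> exists c : F, k = c%:A.
Proof.
have [c0 [c1 [c2 ->]]] := artin_schreier_basis k.
have three0 : 3%:R = 0 :> K := natr3_eq0 (in_alg K) charF3.
rewrite morph_basis Dsigma => /eqP.
rewrite -subr_eq0.
have -> : c0%:A + c1 *: (zeta + 1) + c2 *: (zeta + 1) ^+ 2 -
     (c0%:A + c1 *: zeta + c2 *: zeta ^+ 2) = (c1 + c2)%:A - c2 *: zeta.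
  rewrite -![_ *: zeta]mulr_algl -![_ *: zeta ^+ 2]mulr_algl.
  rewrite -![_ *: (zeta + 1)]mulr_algl -![_ *: (zeta + 1) ^+ 2]mulr_algl.
  rewrite scalerDl.
  transitivity (c1%:A + c2%:A - c2%:A * zeta + 3%:R * (c2%:A * zeta)).
    by ring.
  by rewrite three0 mul0r addr0.
rewrite subr_eq0 => /eqP Dc.
have c2_0 : c2 = 0.
  apply/eqP/negP=> /negP nz_c2.
  apply: (@artin_schreier_generator_nonscalar (c2^-1 * (c1 + c2))).
  by rewrite -scalerA Dc scalerA mulVf // scale1r.
move: Dc; rewrite c2_0 !scale0r !addr0 => /eqP.
rewrite scaler_eq0 oner_eq0 orbF => /eqP->.
by exists c0; rewrite scale0r addr0.
Qed.

Variables (A : unitAlgType F) (f : {lrmorphism K -> A}) (x y : A).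
Hypothesis Df : f zeta = x.
Hypothesis Dyx : y * x = (x + 1) * y.

Lemma twisted_commutation k : y * f k = f (sigma k) * y.
Proof.
have [c0 [c1 [c2 ->]]] := artin_schreier_basis k.
have yx2 : y * x ^+ 2 = (x + 1) ^+ 2 * y.
  by rewrite expr2 mulrA Dyx -mulrA Dyx mulrA -expr2.
rewrite !morph_basis Dsigma !rmorphD /= !linearZ /= rmorphXn !rmorphD /=.
rewrite !rmorph1 !Df.
by rewrite !(mulrDr, mulrDl) -?scalerAr -?scalerAl mulr1 mul1r yx2 Dyx.
Qed.

End ArtinSchreierField.

(** * Symbol algebras as cyclic algebras *)

Lemma symbol3_unit (F : fieldType) (a b : F) (A : unitAlgType F) (x y : A) :
  b != 0 -> symbol3_relations a b x y -> y \is a GRing.unit.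
Proof.
move=> nz_b [_ Dy3 _]; rewrite -(unitrX_pos _ (isT : (0 < 3)%N)) Dy3.
by apply: (rmorph_unit (in_alg A)); rewrite unitfE.
Qed.

Lemma symbol3_commutation (F : fieldType) (a b : F) (A : unitAlgType F)
    (x y : A) :
  b != 0 -> symbol3_relations a b x y -> y * x = (x + 1) * y.
Proof.
move=> nz_b rel; have Uy := symbol3_unit nz_b rel.
by case: rel => _ _ <-; rewrite mulrVK.
Qed.

Lemma symbol3_nonscalar (F : fieldType) (a b : F) (A : unitAlgType F)
    (x y : A) :
  b != 0 -> symbol3_relations a b x y -> forall c, x <> c%:A.
Proof.
move=> nz_b rel c Dx; have Uy := symbol3_unit nz_b rel.
move: rel => [_ _ /eqP]; rewrite Dx -scalerAr mulr1 -scalerAl mulrV //.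
by rewrite addrC -subr_eq subrr eq_sym oner_eq0.
Qed.

(** The universal property maps [A] to the subalgebra [U]; followed by the
    inclusion this fixes [x] and [y], so by uniqueness it is the identity. *)
Lemma symbol3_generated (F : fieldType) (a b : F) (A : falgType F) (x y : A)
    (U : {aspace A}) :
    b != 0 -> presents_symbol3 a b x y -> x \in U -> y \in U ->
  forall u, u \in U.
Proof.
move=> nz_b [rel univ] Ux Uy u.
have unit_y := symbol3_unit nz_b rel.
have algidU : algid U = 1 := unitr_algid1 Uy unit_y.
pose x' : subvs_of U := Subvs Ux; pose y' : subvs_of U := Subvs Uy.
have val1 : vsval (1 : subvs_of U) = 1 by exact: algidU.
have relU : symbol3_relations a b x' y'.
  case: rel => Dx Dy Dyx; split; apply: val_inj.
  - by rewrite /= algidU.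
  - by rewrite /= algidU.
  - by rewrite /= vsval_invr //= algidU.
have [[h [hx hy]] _] := univ _ _ _ relU.
have [_ uniq] := univ _ _ _ rel.
pose g := vsval \o h.
have g_mon : monoid_morphism g.
  by split=> [|v w]; rewrite /g /= ?rmorph1 ?rmorphM.
pose g' : {lrmorphism A -> A} :=
  HB.pack g (GRing.isMonoidMorphism.Build A A g g_mon).
have <- : g' u = u.
  by apply: (uniq g' idfun); rewrite //= /g /= ?hx ?hy.
exact: subvsP.
Qed.

Section CyclicCoordinates.
Variables (F : fieldType) (L : fieldExtType F) (zeta : L) (a b : F).
Variables (sigma : {lrmorphism L -> L}) (A : falgType F) (x y : A).
Variable f : {lrmorphism L -> A}.
Hypothesis nz_b : b != 0.
Hypothesis symA : presents_symbol3 a b x y.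
Hypothesis Df : f zeta = x.
Hypothesis twist : forall k, y * f k = f (sigma k) * y.

Let V : {vspace A} := limg (linfun f).
Let U : {vspace A} := (V + V * <[y]> + V * <[y ^+ 2]>)%VS.

Let memU u :
  u \in U <-> exists c0 c1 c2, u = f c0 + f c1 * y + f c2 * y ^+ 2.
Proof.
have memV k : f k \in V.
  by have <- : linfun f k = f k by [exact: lfunE]; rewrite memv_img ?memvf.
split; last first.
  by case=> c0 [c1 [c2 ->]]; rewrite !memv_add ?memv_mul ?memv_line.
case/memv_addP=> _ /memv_addP[_ /memv_imgP[c0 _ ->] [v Vv ->]] [w Vw ->].
have /memv_cosetP[_ /memv_imgP[c1 _ ->] ->] := Vv.
have /memv_cosetP[_ /memv_imgP[c2 _ ->] ->] := Vw.
by exists c0, c1, c2; rewrite !lfunE.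
Qed.

Let memU_monomial k n : f k * y ^+ n \in U.
Proof.
have Dy3 : y ^+ 3 = b%:A by case: symA => -[].
elim/ltn_ind: n => -[|[|[|n]]] IHn.
- by apply/memU; exists k, 0, 0; rewrite rmorph0 !mul0r !addr0 mulr1.
- by apply/memU; exists 0, k, 0; rewrite rmorph0 !mul0r add0r addr0.
- by apply/memU; exists 0, 0, k; rewrite rmorph0 !mul0r !add0r.
have -> : f k * y ^+ n.+3 = b *: (f k * y ^+ n).
  by rewrite -[n.+3]/(3 + n)%N exprD Dy3 mulr_algl scalerAr.
by rewrite memvZ // IHn // ltnS leqW // leqW.
Qed.

(* Products of the spanning elements stay in U since y normalises f(L). *)
Let mulU : (U * U <= U)%VS.
Proof.
have twistn n k : exists k', y ^+ n * f k = f k' * y ^+ n.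
  elim: n k => [|n IHn] k; first by exists k; rewrite mul1r mulr1.
  have [k' Dk'] := IHn (sigma k).
  by exists k'; rewrite exprSr -mulrA twist mulrA Dk' -mulrA.
have mulU_monomial c n d m : f c * y ^+ n * (f d * y ^+ m) \in U.
  have [d' Dd'] := twistn n d.
  rewrite mulrA -[_ * f d]mulrA Dd' mulrA -rmorphM -mulrA -exprD.
  exact: memU_monomial.
apply/prodvP=> u v /memU[c0 [c1 [c2 ->]]] /memU[d0 [d1 [d2 ->]]].
have mul_y0 c : f c = f c * y ^+ 0 by rewrite mulr1.
rewrite (mul_y0 c0) (mul_y0 d0).
rewrite (_ : f c1 * y = f c1 * y ^+ 1) // (_ : f d1 * y = f d1 * y ^+ 1) //.
by rewrite !mulrDl !mulrDr !rpredD.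
Qed.

Lemma cyclic_coordinates u :
  exists c0 c1 c2, u = f c0 + f c1 * y + f c2 * y ^+ 2.
Proof.
have U1 : 1 \in U.
  by apply/memU; exists 1, 0, 0; rewrite rmorph1 rmorph0 !mul0r !addr0.
have U_asp : is_aspace U by rewrite /is_aspace has_algid1.
apply/memU; apply: (@symbol3_generated _ a b _ x y (ASpace U_asp)) => //.
  by rewrite -Df -[f zeta]mulr1 -(expr0 y) memU_monomial.
by have := memU_monomial 1 1; rewrite rmorph1 mul1r.
Qed.

End CyclicCoordinates.

Section SplitRepresentation.
Variables (F : fieldType) (L : fieldExtType F) (zeta : L) (a b : F).
Variables (sigma : {lrmorphism L -> L}) (A : falgType F) (x y : A).
Variable f : {lrmorphism L -> A}.
Hypothesis charF3 : 3%N \in [pchar F].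
Hypothesis sigma3 : forall k, sigma (sigma (sigma k)) = k.
Hypothesis sigma_fixed : forall k, sigma k = k -> exists c : F, k = c%:A.
Hypothesis nz_b : b != 0.
Hypothesis symA : presents_symbol3 a b x y.
Hypothesis Df : f zeta = x.
Hypothesis twist : forall k, y * f k = f (sigma k) * y.

Let unit_y : y \is a GRing.unit := symbol3_unit nz_b symA.1.

(** The commutator with [x] acts on [f c * y ^+ i] as multiplication by [i],
    which separates the three summands. *)
Lemma cyclic_coordinates_free c0 c1 c2 :
  f c0 + f c1 * y + f c2 * y ^+ 2 = 0 -> [/\ c0 = 0, c1 = 0 & c2 = 0].
Proof.
pose D u := u * x - x * u => c_eq0.
have D_B u v : D (u + v) = D u + D v by rewrite /D mulrDl mulrDr opprD addrACA.
have xf c : x * f c = f c * x by rewrite -Df -!rmorphM mulrC.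
have Dyx : y * x = x * y + y.
  by rewrite (symbol3_commutation nz_b symA.1) mulrDl mul1r.
have Df0 c : D (f c) = 0 by rewrite /D xf subrr.
have Df1 c : D (f c * y) = f c * y.
  by rewrite /D mulrA xf -!mulrA Dyx mulrDr addrC addKr.
have three0 : 3%:R = 0 :> A := natr3_eq0 (in_alg A) charF3.
have twice (v : A) : v + v = - v.
  apply/eqP; rewrite -subr_eq0 opprK -[v]mul1r -!mulrDl -addrA.
  by rewrite -[1 + (1 + 1)]/(3%:R : A) three0 mul0r.
have Df2 c : D (f c * y ^+ 2) = - (f c * y ^+ 2).
  have Dyyx : y ^+ 2 * x = x * y ^+ 2 - y ^+ 2.
    by rewrite expr2 -mulrA Dyx mulrDr mulrA Dyx mulrDl -addrA twice -mulrA.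
  rewrite /D -(mulrA (f c)) (mulrA x) xf -(mulrA (f c) x) Dyyx mulrBr.
  by rewrite addrAC subrr add0r.
have cancel_y c n : f c * y ^+ n = 0 -> c = 0.
  move/(congr1 ( *%R^~ (y ^- n))); rewrite mulrK ?unitrX // mul0r => /eqP.
  by rewrite fmorph_eq0 => /eqP.
have D0 : D 0 = 0 by rewrite /D mul0r mulr0 subrr.
have D1 : f c1 * y - f c2 * y ^+ 2 = 0.
  by rewrite -D0 -c_eq0 !D_B Df0 Df1 Df2 add0r.
have D2 : f c1 * y + f c2 * y ^+ 2 = 0.
  rewrite -{}D0 -D1 D_B Df1; congr (_ + _).
  by rewrite -mulNr -rmorphN Df2 rmorphN mulNr opprK.
have c2_0 : c2 = 0.
  apply: (cancel_y _ 2); apply: oppr_inj; rewrite oppr0 -twice.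
  by rewrite -[X in X + _](subr0_eq D1).
have c1_0 : c1 = 0.
  by apply: (cancel_y _ 1); rewrite expr1 (subr0_eq D1) c2_0 rmorph0 mul0r.
by move/eqP: c_eq0; rewrite c1_0 c2_0 rmorph0 !mul0r !addr0 fmorph_eq0 => /eqP.
Qed.

(* M is the matrix of right multiplication by u in the basis 1, y, y ^+ 2 of A
   as a left vector space over f(L). *)
Let represents u (M : 'M[L]_3) :=
  [forall i : 'I_3, y ^+ i * u == \sum_(j < 3) f (M i j) * y ^+ j].

Let representsP u (M : 'M[L]_3) :
  reflect (forall i : 'I_3, y ^+ i * u = \sum_(j < 3) f (M i j) * y ^+ j)
          (represents u M).
Proof. exact: 'forall_eqP. Qed.

Let represents_uniq u (M N : 'M[L]_3) :
  represents u M -> represents u N -> M = N.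
Proof.
move=> /representsP uM /representsP uN; apply/matrixP=> i j.
have := uM i; rewrite uN => /eqP; rewrite -subr_eq0 -sumrB.
under eq_bigr do rewrite -mulrBl -rmorphB.
rewrite !big_ord_recl big_ord0 /= addr0 mulr1 addrA => /eqP.
case/cyclic_coordinates_free=> /subr0_eq D0 /subr0_eq D1 /subr0_eq D2.
by case: j => -[|[|[|]]] // ltj3; [move: D0 | move: D1 | move: D2] => /esym;
  congr (M i _ = N i _); apply: val_inj.
Qed.

Let cyclic_mx c0 c1 c2 : 'M[L]_3 := \matrix_(i, j)
  nth 0 (nth [::]
    [:: [:: c0; c1; c2];
        [:: b *: sigma c2; sigma c0; sigma c1];
        [:: b *: sigma (sigma c1); b *: sigma (sigma c2); sigma (sigma c0)]]
    i) j.

Let represents_cyclic c0 c1 c2 :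
  represents (f c0 + f c1 * y + f c2 * y ^+ 2) (cyclic_mx c0 c1 c2).
Proof.
have Dy3 : y ^+ 3 = b%:A by case: symA => -[].
have fZ c k : f (c *: k) = c *: f k by rewrite linearZ.
have twist2 k : y ^+ 2 * f k = f (sigma (sigma k)) * y ^+ 2.
  by rewrite expr2 -mulrA twist mulrA twist -mulrA.
have wrap c d : f c * (y ^+ 3 * d) = f (b *: c) * d.
  by rewrite Dy3 fZ mulr_algl -scalerAr -scalerAl.
apply/representsP=> -[[|[|[|]]] // lti3];
  rewrite !big_ord_recl big_ord0 !mxE /=.
- by rewrite mul1r mulr1 addr0 addrA.
- rewrite expr1 !mulrDr [y * (f c1 * y)]mulrA [y * (f c2 * _)]mulrA !twist.
  rewrite -[_ * y * y]mulrA -[_ * y * _]mulrA -exprS -[y ^+ 3]mulr1 wrap addr0.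
  by rewrite addrC.
- rewrite !mulrDr [_ * (f c1 * y)]mulrA [_ * (f c2 * _)]mulrA !twist2.
  rewrite -[_ * _ * y]mulrA -[_ * _ * y ^+ 2]mulrA -exprSr -[y ^+ 3]mulr1 wrap.
  rewrite -exprD (exprD y 3 1) wrap addr0.
  by rewrite -addrA addrC -addrA.
Qed.

Let represents_exists u : exists M, represents u M.
Proof.
have [c0 [c1 [c2 ->]]] := cyclic_coordinates nz_b symA Df twist u.
by exists (cyclic_mx c0 c1 c2); apply: represents_cyclic.
Qed.

Let rho u := xchoose (represents_exists u).

Let rhoP u M : represents u M -> rho u = M.
Proof. exact/represents_uniq/xchooseP. Qed.

Let rhoE u (i : 'I_3) : y ^+ i * u = \sum_j f (rho u i j) * y ^+ j.
Proof. by move: i; apply/representsP/xchooseP. Qed.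

(** Right multiplication of [A] on itself, which is linear over the maximal
    subfield [f(L)] acting on the left.  The diagonal of the matrix of [u] is a
    full [sigma]-orbit, so its trace lies in [F]; and an element acting as a
    scalar [m] of [L] is [f m] and commutes with [y], so it lies in [F] too. *)
Lemma split_representation :
  exists r : {rmorphism A -> 'M[L]_3},
  [/\ forall c, r c%:A = (c%:A)%:M,
      forall u, exists c : F, \tr (r u) = c%:A
    & forall u m, r u = m%:M -> exists c : F, u = c%:A].
Proof.
have rho_scal c : rho c%:A = (c%:A)%:M.
  apply/rhoP/representsP=> i.
  rewrite (bigD1 i) //= big1 ?addr0 => [|j /negPf ji].
    rewrite mxE eqxx mulr1n linearZ /= rmorph1 -scalerAl -scalerAr.
    by rewrite mul1r mulr1.
  by rewrite mxE eq_sym ji mulr0n rmorph0 mul0r.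
have rho_add : zmod_morphism rho.
  move=> u v; apply/rhoP/representsP=> i; rewrite mulrBr !rhoE -sumrB.
  by apply: eq_bigr => j _; rewrite !mxE rmorphB mulrBl.
have rho_mul : monoid_morphism rho.
  split=> [|u v]; first by rewrite -[1 in LHS]scale1r rho_scal scale1r.
  apply/rhoP/representsP=> i; rewrite mulrA rhoE mulr_suml.
  under eq_bigr do rewrite -mulrA rhoE mulr_sumr.
  rewrite exchange_big; apply: eq_bigr => j _ /=.
  rewrite mxE rmorph_sum mulr_suml; apply: eq_bigr => k _.
  by rewrite rmorphM mulrA.
pose r : {rmorphism A -> 'M[L]_3} := HB.pack rho
  (GRing.isZmodMorphism.Build A 'M[L]_3 rho rho_add)
  (GRing.isMonoidMorphism.Build A 'M[L]_3 rho rho_mul).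
exists r; split=> //= [u | u m Du].
  have [c0 [c1 [c2 ->]]] := cyclic_coordinates nz_b symA Df twist u.
  rewrite (rhoP (represents_cyclic c0 c1 c2)) /mxtrace.
  rewrite !big_ord_recl big_ord0 !mxE /=.
  by apply: sigma_fixed; rewrite !rmorphD rmorph0 /= sigma3 !addr0 addrC -addrA.
have u_eq (i : 'I_3) : y ^+ i * u = f m * y ^+ i.
  rewrite rhoE Du (bigD1 i) //= big1 ?addr0 => [|j /negPf ji].
    by rewrite mxE eqxx.
  by rewrite mxE eq_sym ji rmorph0 mul0r.
have Dm : u = f m by have := u_eq 0; rewrite mul1r mulr1.
have [|c Dc] := @sigma_fixed m.
  apply: (fmorph_inj f); apply: (mulIr unit_y).
  by rewrite -twist -Dm; apply: (u_eq 1).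
by exists c; rewrite Dm Dc linearZ /= rmorph1.
Qed.

End SplitRepresentation.

(** * Reduced trace and norm *)

(** In characteristic 3 the sum of the principal 2 x 2 minors, which is half
    of [(\tr M) ^+ 2 - \tr (M ^+ 2)], is [\tr (M ^+ 2) - (\tr M) ^+ 2]. *)
Lemma cayley_hamilton_mx3 (R : comNzRingType) (M : 'M[R]_3) :
  3%:R = 0 :> R ->
  M ^+ 3 - \tr M *: M ^+ 2 + (\tr (M ^+ 2) - \tr M ^+ 2) *: M = (\det M)%:M.
Proof.
move=> three0; pose g (i j : nat) : R := M (inord i) (inord j).
have gE i j : M i j = g i j by rewrite /g !inord_val.
have detM : \det M =
  g 0%N 0%N * (g 1%N 1%N * g 2%N 2%N - g 1%N 2%N * g 2%N 1%N)
  - g 0%N 1%N * (g 1%N 0%N * g 2%N 2%N - g 1%N 2%N * g 2%N 0%N)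
  + g 0%N 2%N * (g 1%N 0%N * g 2%N 1%N - g 1%N 1%N * g 2%N 0%N).
  rewrite (expand_det_row _ ord0) !big_ord_recl big_ord0 /cofactor.
  rewrite !(expand_det_row _ ord0) !big_ord_recl !big_ord0 /cofactor !det_mx11.
  by rewrite !mxE !gE /= /bump /= ?add0n ?add1n; ring.
have M2E i j : (M ^+ 2) i j = \sum_(k < 3) M i k * M k j by rewrite mxE.
have M3E i j : (M ^+ 3) i j = \sum_(k < 3) M i k * (M ^+ 2) k j by rewrite mxE.
pose S := g 0%N 0%N * g 1%N 1%N - g 0%N 1%N * g 1%N 0%N
        + (g 0%N 0%N * g 2%N 2%N - g 0%N 2%N * g 2%N 0%N)
        + (g 1%N 1%N * g 2%N 2%N - g 1%N 2%N * g 2%N 1%N).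
have -> : \tr (M ^+ 2) - \tr M ^+ 2 = S.
  transitivity (S - 3%:R * S); last by rewrite three0 mul0r subr0.
  rewrite /S /mxtrace !big_ord_recl !big_ord0 !M2E !big_ord_recl !big_ord0 !gE.
  by rewrite /= /bump /= ?add0n ?add1n; ring.
rewrite detM /mxtrace; apply/matrixP=> i j.
rewrite mxE [RHS]mxE mxE [X in _ + X]mxE [X in _ + X + _]mxE.
rewrite [X in _ - X + _]mxE.
rewrite M3E !big_ord_recl !big_ord0 !M2E !big_ord_recl !big_ord0 !gE /S.
case: i j => -[|[|[|]]] // lti [[|[|[|]]] // ltj];
  by rewrite -val_eqE /= /bump /= ?add0n ?add1n ?mulr1n ?mulr0n; ring.
Qed.

(** The Cayley-Hamilton identity of the split representation descends to [F].
    The trace coefficients are in [F], hence so is the determinant, because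
    the scalar matrix with that entry is the image of an element of [A]. *)
Lemma reduced_trace_norm (F : fieldType) (A : falgType F) :
    3%N \in [pchar F] -> quadratically_closed F ->
    is_symbol3_algebra A -> is_division_algebra A ->
  exists trd nrd : A -> F,
  [/\ forall c u v, trd (c *: u + v) = c * trd u + trd v,
      forall u v, nrd (u * v) = nrd u * nrd v
    & forall u, u ^+ 3 - trd u *: u ^+ 2 + (trd (u ^+ 2) - trd u ^+ 2) *: u
                  = (nrd u)%:A].
Proof.
move=> charF3 qcF [a [b [nz_b [x [y symA]]]]] divA.
have x'F := symbol3_nonscalar nz_b symA.1.
have Dx : x ^+ 3 - x = a%:A by case: symA => -[].
have [L [_ [zeta [Dzeta genL [sigma Dsigma] lift]]]] :=
  artin_schreier_subfield charF3 qcF divA x'F Dx.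
have three0L : 3%:R = 0 :> L := natr3_eq0 (in_alg L) charF3.
have [f Df] := lift A x Dx.
have twist := twisted_commutation Dzeta genL Dsigma Df
  (symbol3_commutation nz_b symA.1).
have [rho [rhoF rho_tr rho_scal]] := split_representation charF3
  (artin_schreier_aut_order charF3 Dzeta genL Dsigma)
  (artin_schreier_aut_fixed charF3 Dzeta genL Dsigma) nz_b symA Df twist.
have rhoZ c u : rho (c *: u) = c%:A *: rho u.
  by rewrite -[c *: u]mulr_algl rmorphM rhoF -mulmxE mul_scalar_mx.
have trE u : exists c : F, \tr (rho u) == c%:A.
  by have [c ->] := rho_tr u; exists c.
pose trd u := xchoose (trE u).
have trdE u : \tr (rho u) = (trd u)%:A by apply/eqP/(xchooseP (trE u)).
have inj_alg : injective (fun c : F => c%:A : L) := fmorph_inj (in_alg L).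
have chE u : rho (u ^+ 3 - trd u *: u ^+ 2 + (trd (u ^+ 2) - trd u ^+ 2) *: u)
    = (\det (rho u))%:M.
  rewrite -cayley_hamilton_mx3 // -rmorphXn !trdE rmorphD rmorphB /= !rhoZ.
  by rewrite scalerBl -(trdE (u ^+ 2)) !rmorphXn exprZn expr1n.
have inj_scal : injective (fun k : L => k%:M : 'M_3).
  by move=> k l /matrixP/(_ ord0 ord0); rewrite !mxE.
have detE u : exists c : F, \det (rho u) == c%:A.
  have [c Dc] := rho_scal _ _ (chE u); exists c; apply/eqP/inj_scal.
  by rewrite -rhoF -chE Dc.
pose nrd u := xchoose (detE u).
have nrdE u : \det (rho u) = (nrd u)%:A by apply/eqP/(xchooseP (detE u)).
exists trd, nrd; split=> [c v w | v w | v].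
- apply: inj_alg; rewrite -trdE rmorphD /= rhoZ mxtraceD mxtraceZ !trdE.
  by rewrite scalerDl -scalerA mulr_algl.
- apply: inj_alg; rewrite -nrdE rmorphM -mulmxE det_mulmx !nrdE.
  by rewrite mulr_algl scalerA.
- have [c Dc] := rho_scal _ _ (chE v); rewrite Dc; congr (_ *: _).
  by apply/inj_alg/inj_scal; rewrite -rhoF -nrdE -chE Dc.
Qed.

(** * The common inseparable subfield *)

Section TwistedCubes.
Variables (F : fieldType) (L : fieldExtType F) (A : unitAlgType F).
Variables (sigma : {lrmorphism L -> L}) (f : {lrmorphism L -> A}) (y : A).
Hypothesis sigma3 : forall k, sigma (sigma (sigma k)) = k.
Hypothesis Uy : y \is a GRing.unit.
Hypothesis twist : forall k, y * f k = f (sigma k) * y.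

Let twistV k : y^-1 * f k = f (sigma (sigma k)) * y^-1.
Proof. by apply: (mulrI Uy); rewrite mulVKr // mulrA twist sigma3 mulrK. Qed.

Let twistV2 k : y^-1 ^+ 2 * f k = f (sigma k) * y^-1 ^+ 2.
Proof. by rewrite expr2 -mulrA twistV mulrA twistV !sigma3 -mulrA. Qed.

Let twisted_square q :
  (f q * y^-1) ^+ 2 = f (q * sigma (sigma q)) * y^-1 ^+ 2.
Proof. by rewrite !expr2 -!mulrA (mulrA y^-1) twistV rmorphM -!mulrA. Qed.

Lemma twisted_cube q :
  (f q * y^-1) ^+ 3 = f (q * sigma q * sigma (sigma q)) * y ^- 3.
Proof.
rewrite exprSr twisted_square -mulrA (mulrA (y^-1 ^+ 2)) twistV2.
by rewrite -(mulrA (f _)) -exprSr exprVn mulrA -rmorphM mulrAC.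
Qed.

(** The mixed terms of the cube collect into [q + sigma q + sigma (sigma q)]
    times [y + f q * y^-1]. *)
Lemma twisted_cube_sum q :
    q + sigma q + sigma (sigma q) = 1 ->
  (y + f q * y^-1) ^+ 3
    = y ^+ 3 + (y + f q * y^-1) + f (q * sigma q * sigma (sigma q)) * y ^- 3.
Proof.
move=> tr_q; set v := f q * y^-1.
have yv : y * v = f (sigma q) by rewrite /v mulrA twist mulrK.
have vy : v * y = f q by rewrite /v mulrVK.
have sq : (y + v) ^+ 2 = y ^+ 2 + f (q + sigma q) + v ^+ 2.
  rewrite expr2 mulrDl !mulrDr yv vy -!expr2 rmorphD.
  by rewrite addrA [f q + _]addrC -!addrA.
have yyv : y ^+ 2 * v = f (sigma (sigma q)) * y.
  by rewrite expr2 -mulrA yv twist.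
have vvy : v ^+ 2 * y = f (sigma (sigma q)) * v.
  rewrite expr2 -mulrA vy -(mulrA (f q)) twistV mulrA -rmorphM mulrC.
  by rewrite rmorphM -mulrA.
rewrite exprSr sq mulrDr !mulrDl yyv vvy -!exprSr twisted_cube.
have fq1 : f (sigma (sigma q)) = 1 - f (q + sigma q).
  by rewrite -(rmorph1 f) -tr_q !rmorphD /= addrC addKr.
rewrite fq1 !mulrBl !mul1r.
rewrite -!addrA; congr (_ + _).
rewrite (addrCA y) [- _ + (- _ + _)]addrCA (addrCA v (- (f _ * y))) addNKr.
by rewrite (addrCA y (f _ * v)) addKr addrCA.
Qed.

End TwistedCubes.

(** The conditions [trd (f k * w) = 0] and [trd ((f k * w) ^+ 2) = 0] are one
    linear and one quadratic equation for [k] in a three-dimensional space, and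
    they make [(f k * w) ^+ 3] equal to [nrd (f k) * nrd w]. *)
Lemma twist_into_pure_cube (F : fieldType) (L : fieldExtType F) (zeta : L)
    (a : F) (sigma : {lrmorphism L -> L}) (B : falgType F)
    (f : {lrmorphism L -> B}) (w : B) (c : F) :
    3%N \in [pchar F] -> quadratically_closed F ->
    zeta ^+ 3 - zeta = a%:A -> <<1; zeta>>%VS = fullv ->
    sigma zeta = zeta + 1 ->
    is_symbol3_algebra B -> is_division_algebra B ->
    (forall s, w <> s%:A) -> w ^+ 3 - w = c%:A ->
  exists (k : L) (n : F),
    [/\ k != 0, k * sigma k * sigma (sigma k) = n%:A
      & (f k * w) ^+ 3 = (n * c)%:A].
Proof.
move=> charF3 qcF Dzeta genL Dsigma symB divB w'F Dw.
have [trd [nrd [trd_lin nrdM ch]]] := reduced_trace_norm charF3 qcF symB divB.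
have trd0 : trd 0 = 0.
  have := trd_lin 1 0 0; rewrite scale1r addr0 mul1r => /eqP.
  by rewrite -subr_eq subrr eq_sym => /eqP.
have trdD u v : trd (u + v) = trd u + trd v.
  by rewrite -[u]scale1r trd_lin mul1r scale1r.
have trdZ s u : trd (s *: u) = s * trd u.
  by rewrite -[s *: u]addr0 trd_lin trd0 addr0.
have ch_uniq u (t s n : F) : (forall r, u <> r%:A) ->
    u ^+ 3 - t *: u ^+ 2 + s *: u = n%:A ->
  [/\ trd u = t, trd (u ^+ 2) - trd u ^+ 2 = s & nrd u = n].
  by move=> u'F; apply: nonscalar_cubic_unique (ch u).
have [w_tr w_tr2 w_nrd] : [/\ trd w = 0, trd (w ^+ 2) = -1 & nrd w = c].
  have [|-> <- ->] := @ch_uniq w 0 (-1) c w'F.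
    by rewrite scale0r subr0 scaleN1r.
  by rewrite expr0n subr0.
(* As trd w = 0, the scalar 1 solves the linear condition on k; a second
   solution u is found in the span of zeta and zeta ^+ 2. *)
have [p1 [p2 [p_neq0 p_tr]]] : exists p1 p2 : F, ((p1 != 0) || (p2 != 0)) /\
    p1 * trd (f zeta * w) + p2 * trd (f (zeta ^+ 2) * w) = 0.
  have [t2_0 | nz_t2] := eqVneq (trd (f (zeta ^+ 2) * w)) 0.
    by exists 0, 1; rewrite oner_neq0 orbT t2_0 mul0r mulr0 addr0.
  exists (trd (f (zeta ^+ 2) * w)), (- trd (f zeta * w)).
  by rewrite nz_t2 mulNr mulrC subrr.
pose u := p1 *: zeta + p2 *: zeta ^+ 2; pose v := f u * w.
have v_tr : trd v = 0.
  by rewrite /v rmorphD /= !linearZ /= mulrDl -!scalerAl trdD !trdZ.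
(* The root s of q makes k = s + u isotropic, the coefficient of s ^+ 2 in
   trd ((f k * w) ^+ 2) being trd (w ^+ 2) = -1. *)
have [m Dm] : exists m, m = trd (w * v + v * w) by exists (trd (w * v + v * w)).
pose q : {poly F} := 'X^2 - (m *: 'X + (trd (v ^+ 2))%:P).
have size_q : size q = 3%N.
  rewrite size_polyDl ?size_polyXn // size_polyN ltnS.
  rewrite (leq_trans (size_polyD _ _)) // geq_max size_polyC.
  by rewrite (leq_trans (size_scale_leq _ _)) ?size_polyX //; case: eqP.
have [s /rootP] := quadratically_closed_root qcF size_q.
rewrite !hornerE /= => Ds.
pose k := s%:A + u; have Dk : f k * w = s *: w + v.
  by rewrite rmorphD /= linearZ /= rmorph1 mulrDl mulr_algl.
have k_tr : trd (f k * w) = 0 by rewrite Dk trdD trdZ w_tr v_tr mulr0 addr0.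
have k_tr2 : trd ((f k * w) ^+ 2) = 0.
  rewrite Dk expr2 mulrDl !mulrDr -!scalerAl -!scalerAr.
  by rewrite !trdD !trdZ -!expr2 w_tr2 -[RHS]oppr0 -Ds Dm (trdD (w * v)); ring.
have algf e : e%:A = f e%:A by rewrite linearZ /= rmorph1.
have z'F r : f zeta <> r%:A.
  by rewrite algf => /fmorph_inj/(artin_schreier_generator_nonscalar Dsigma).
have k'F r : k <> r%:A.
  move=> /(congr1 f); rewrite -algf /k /u !rmorphD /= !linearZ /=.
  rewrite rmorphXn rmorph1 => Dr.
  have [|_ p1_0 p2_0] := @nonscalar_relation _ _ _ (s - r) p1 p2 qcF divB z'F.
    by rewrite scalerBl -Dr opprD addNKr -addrA addNr.
  by move: p_neq0; rewrite p1_0 p2_0 eqxx.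
(* The characteristic polynomial of k over F has the roots k, sigma k and
   sigma (sigma k), which identifies the reduced norm of f k. *)
clearbody k; have sigma3 := artin_schreier_aut_order charF3 Dzeta genL Dsigma.
have inF := artin_schreier_aut_fixed charF3 Dzeta genL Dsigma.
have [n Dn] : exists n : F, k * sigma k * sigma (sigma k) = n%:A.
  by apply: inF; rewrite !rmorphM /= sigma3 mulrC mulrA.
have [t Dt] : exists t : F, k + sigma k + sigma (sigma k) = t%:A.
  by apply: inF; rewrite !rmorphD /= sigma3 addrC addrA.
have [r Dr] : exists r : F,
    k * sigma k + sigma k * sigma (sigma k) + sigma (sigma k) * k = r%:A.
  by apply: inF; rewrite !(rmorphD, rmorphM) /= sigma3 addrC addrA.
have k_nrd : nrd (f k) = n.
  have [r0||//] := @ch_uniq (f k) t r n.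
    by rewrite algf => /fmorph_inj/k'F.
  have Dk3 : k ^+ 3 - t *: k ^+ 2 + r *: k = n%:A.
    by rewrite -[t *: _]mulr_algl -[r *: _]mulr_algl -Dt -Dr -Dn; ring.
  by rewrite algf -Dk3 rmorphD rmorphB /= !linearZ /= !rmorphXn.
exists k, n; split=> //.
  by apply/eqP=> k0; apply: (k'F 0); rewrite k0 scale0r.
have := ch (f k * w).
rewrite k_tr k_tr2 expr0n subrr !scale0r subr0 addr0 => ->.
by rewrite nrdM k_nrd w_nrd.
Qed.

Lemma artin_schreier_norm_identity (F : fieldType) (L : fieldExtType F)
    (zeta : L) (a d : F) :
    3%N \in [pchar F] -> zeta ^+ 3 - zeta = a%:A ->
  let q := d%:A - zeta ^+ 2 in
  let q1 := d%:A - (zeta + 1) ^+ 2 in let q2 := d%:A - (zeta + 1 + 1) ^+ 2 in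
  q + q1 + q2 = 1 /\ q * q1 * q2 = (d ^+ 3 + d ^+ 2 + d - a ^+ 2)%:A.
Proof.
move=> charF3 Dzeta /=.
have three0 : 3%:R = 0 :> L := natr3_eq0 (in_alg L) charF3.
have -> : (d ^+ 3 + d ^+ 2 + d - a ^+ 2)%:A
    = d%:A ^+ 3 + d%:A ^+ 2 + d%:A - (zeta ^+ 3 - zeta) ^+ 2 :> L.
  by rewrite Dzeta -!in_algE !(rmorphB, rmorphD, rmorphXn).
move: (d%:A) => e; split.
  transitivity (1 + 3%:R * (e - zeta ^+ 2 - 2%:R * zeta - 2%:R)); first by ring.
  by rewrite three0 mul0r addr0.
transitivity (e ^+ 3 + e ^+ 2 + e - (zeta ^+ 3 - zeta) ^+ 2
  + 3%:R * (- (zeta ^+ 2 + 2%:R * zeta + 2%:R) * e ^+ 2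
    + (zeta ^+ 4 + 4%:R * zeta ^+ 3 + 6%:R * zeta ^+ 2 + 4%:R * zeta + 1) * e
    - (zeta ^+ 2 + zeta) * (2%:R * zeta ^+ 3 + 3%:R * zeta ^+ 2 + zeta))).
  by ring.
by rewrite three0 mul0r addr0.
Qed.

Section SymbolElements.
Variables (F : fieldType) (L : fieldExtType F) (zeta : L) (a b : F).
Variables (sigma : {lrmorphism L -> L}) (A : unitAlgType F) (x y : A).
Variable f : {lrmorphism L -> A}.
Hypothesis charF3 : 3%N \in [pchar F].
Hypothesis nz_b : b != 0.
Hypothesis rel : symbol3_relations a b x y.
Hypothesis Dzeta : zeta ^+ 3 - zeta = a%:A.
Hypothesis genL : <<1; zeta>>%VS = fullv.
Hypothesis Dsigma : sigma zeta = zeta + 1.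
Hypothesis Df : f zeta = x.

Let Uy : y \is a GRing.unit := symbol3_unit nz_b rel.
Let twist := twisted_commutation Dzeta genL Dsigma Df
  (symbol3_commutation nz_b rel).
Let sigma3 := artin_schreier_aut_order charF3 Dzeta genL Dsigma.

Let yx : y * x = x * y + y.
Proof. by rewrite (symbol3_commutation nz_b rel) mulrDl mul1r. Qed.

Let fyVx k : f k * y^-1 * x = x * (f k * y^-1) - f k * y^-1.
Proof.
have yVx : y^-1 * x = x * y^-1 - y^-1.
  apply: (mulrI Uy); rewrite mulVKr // mulrBr !mulrA yx mulrDl mulrK //.
  by rewrite mulrV // addrK.
by rewrite -mulrA yVx mulrBr !mulrA -Df -!rmorphM mulrC.
Qed.

Let scalar_comm u c : u = c%:A -> u * x = x * u.
Proof. by move=> ->; rewrite mulr_algl mulr_algr. Qed.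

Let eq0_of_addr (u v : A) : v = v + u -> u = 0.
Proof. by move/eqP; rewrite addrC -subr_eq subrr eq_sym => /eqP. Qed.

Lemma symbol3_monomial_nonscalar k c : k != 0 -> f k * y^-1 <> c%:A.
Proof.
move=> nz_k /scalar_comm/esym; rewrite fyVx => /eq0_of_addr/eqP.
rewrite oppr_eq0 => /eqP fkV; have /eqP: f k = 0.
  by rewrite -(mulrVK Uy (f k)) fkV mul0r.
by rewrite fmorph_eq0 (negPf nz_k).
Qed.

Lemma symbol3_binomial_nonscalar k c : y + f k * y^-1 <> c%:A.
Proof.
move=> Dc; have := scalar_comm Dc.
rewrite mulrDl fyVx yx [x * (_ + _)]mulrDr addrACA.
move=> /esym/eq0_of_addr/subr0_eq y_fyV.
have y_c : y = (- c)%:A.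
  (* y + y = - y in characteristic 3. *)
  rewrite scaleNr -Dc -[f k * _]y_fyV; apply/eqP.
  rewrite -addr_eq0 -[_ + _]/(y *+ 3) -mulr_natl.
  by rewrite (natr3_eq0 (in_alg A) charF3) mul0r.
have y0 : y = 0.
  by apply: (@eq0_of_addr _ (x * y)); rewrite -yx (scalar_comm y_c).
by move: Uy; rewrite y0 unitr0.
Qed.

Let Dy3V : y ^- 3 = (b^-1)%:A.
Proof. by case: rel => _ -> _; rewrite -!in_algE fmorphV. Qed.

Lemma symbol3_monomial_cube (d n : F) k :
    k * sigma k * sigma (sigma k) = n%:A ->
  (f (d *: k) * y^-1) ^+ 3 = (n * (d ^+ 3 / b))%:A.
Proof.
move=> Dn; rewrite (twisted_cube sigma3 Uy twist) !linearZ /=.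
have -> : d *: k * (d *: sigma k) * (d *: sigma (sigma k)) = (d ^+ 3 * n)%:A.
  transitivity (d%:A ^+ 3 * (k * sigma k * sigma (sigma k))).
    rewrite -[d *: k]mulr_algl -[d *: sigma k]mulr_algl.
    by rewrite -[d *: sigma (sigma k)]mulr_algl; ring.
  by rewrite Dn exprZn expr1n mulr_algl scalerA.
rewrite linearZ /= rmorph1 Dy3V mulr_algl scalerA.
by congr (_ *: _); ring.
Qed.

(** The element [y + f q * y^-1] with [q = d - zeta ^+ 2] of trace 1 is an
    Artin-Schreier element with constant [b + N(q) / b], where
    [N(q) = d ^+ 3 + d ^+ 2 + d - a ^+ 2]; the equation chosen for [d] reduces
    that constant to [d ^+ 3 / b]. *)
Lemma symbol3_cyclic_generator :
    quadratically_closed F -> is_division_algebra A ->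
  exists (d : F) (z : A),
    [/\ d != 0, forall c, z <> c%:A & z ^+ 3 - z = (d ^+ 3 / b)%:A].
Proof.
move=> qcF divA; have algf e : e%:A = f e%:A by rewrite linearZ /= rmorph1.
have [d Dd] : exists d : F, d ^+ 2 + d + (b ^+ 2 - a ^+ 2) = 0.
  have size_p : size ('X^2 + ('X + (b ^+ 2 - a ^+ 2)%:P) : {poly F}) = 3%N.
    by rewrite size_polyDl ?size_polyXn ?size_XaddC.
  have [d /rootP] := quadratically_closed_root qcF size_p.
  by rewrite !hornerD hornerXn hornerX hornerC addrA => Dd; exists d.
pose q := d%:A - zeta ^+ 2.
have [q_tr q_nrd] : q + sigma q + sigma (sigma q) = 1 /\
    q * sigma q * sigma (sigma q) = (d ^+ 3 + d ^+ 2 + d - a ^+ 2)%:A.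
  have -> : sigma q = d%:A - (zeta + 1) ^+ 2.
    by rewrite rmorphB rmorphXn /= Dsigma linearZ /= rmorph1.
  rewrite rmorphB /= rmorphXn rmorphD /= Dsigma linearZ /= rmorph1.
  exact: artin_schreier_norm_identity.
pose z := y + f q * y^-1; have z'F := @symbol3_binomial_nonscalar q.
have Dz : z ^+ 3 - z = (d ^+ 3 / b)%:A.
  rewrite (twisted_cube_sum sigma3 Uy twist q_tr) -/z addrAC addrK q_nrd -algf.
  rewrite Dy3V (_ : y ^+ 3 = b%:A); last by case: rel.
  rewrite mulr_algl scalerA -scalerDl; congr (_ *: _).
  have Dd3 : d ^+ 3 = d ^+ 3 + d ^+ 2 + d - a ^+ 2 + b ^+ 2.
    by rewrite -[LHS]addr0 -Dd; ring.
  by rewrite [in RHS]Dd3; field.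
exists d, z; split=> //; apply/eqP=> d0.
(* Otherwise z ^+ 3 = z, and then z ^+ 2 = 1. *)
move: Dz; rewrite d0 expr0n mul0r scale0r => z3.
have Uz : z \is a GRing.unit.
  by apply: divA; apply/eqP=> z0; apply: (z'F 0); rewrite -/z z0 scale0r.
have [|/eqP] := @nonscalar_relation _ _ z (-1) 0 1 qcF divA z'F.
  apply: (mulrI Uz); rewrite mulr0 -z3 scale0r addr0 scale1r scaleN1r.
  by rewrite mulrDr mulrN1 addrC -exprS.
by rewrite oppr_eq0 oner_eq0.
Qed.

End SymbolElements.

Theorem corollary4p7 (F : fieldType) (charF3 : 3%N \in [pchar F])
    (qcF : quadratically_closed F) (A B : falgType F)
    (symA : is_symbol3_algebra A) (symB : is_symbol3_algebra B)
    (divA : is_division_algebra A) (divB : is_division_algebra B)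
    (linkAB : totally_cyclically_linked A B) :
  inseparably_linked A B.
Proof.
have [a [b [nz_b [x [y [rel _]]]]]] := symA; have [Dx _ _] := rel.
have [L [cycL [zeta [Dzeta genL [sigma Dsigma] liftL]]]] :=
  artin_schreier_subfield charF3 qcF divA (symbol3_nonscalar nz_b rel) Dx.
have [f Df] := liftL A x Dx.
have [d [z [nz_d z'F Dz]]] :=
  symbol3_cyclic_generator charF3 nz_b rel Dzeta genL Dsigma Df qcF divA.
have [K [cycK [xi [Dxi _ _ liftK]]]] :=
  artin_schreier_subfield charF3 qcF divA z'F Dz.
have [g Dg] := liftK A z Dz.
have emb (E : fieldExtType F) (C : unitAlgType F) :
    {lrmorphism E -> C} -> embeds_in E C.
  by move=> i; exists i; apply: fmorph_inj.
have [fB _] : embeds_in L B by apply/(linkAB L cycL); apply: emb f.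
have [h _] : embeds_in K B by apply/(linkAB K cycK); apply: emb g.
have Dw : h xi ^+ 3 - h xi = (d ^+ 3 / b)%:A.
  by rewrite -rmorphXn -rmorphB Dxi /= linearZ /= rmorph1.
have w'F c : h xi <> c%:A.
  have -> : c%:A = h c%:A by rewrite linearZ /= rmorph1.
  move=> /fmorph_inj Dxi_c; apply: (z'F c).
  by rewrite -Dg Dxi_c linearZ /= rmorph1.
have [k [n [nz_k Dn cubeB]]] :=
  twist_into_pure_cube fB charF3 qcF Dzeta genL Dsigma symB divB w'F Dw.
have cubeA := symbol3_monomial_cube charF3 nz_b rel Dzeta genL Dsigma Df d Dn.
have e'F c : f (d *: k) * y^-1 <> c%:A.
  apply: (symbol3_monomial_nonscalar nz_b rel Df).
  by rewrite scaler_eq0 negb_or nz_d.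
have [E [dimE insE embE]] :=
  inseparable_cubic_subfield charF3 qcF divA e'F cubeA.
by exists E; split=> //; [apply: embE cubeA | apply: embE cubeB].
Qed.
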